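(* Let $X\in\mathrm{iSt}_{A,J}(p,n)$ and $\xi,\eta\in T_X\mathrm{iSt}_{A,J}(p,n)$, and let $\Omega_{X,\xi}:=X^\top A\xi$ and $\Omega_{X,\eta}:=X^\top A\eta$, which belong to $\mathrm{Skew}(p)$. Then $$P_X^{G^{(1)}}\big(\Gamma_X^{(1)}(\xi,\eta)\big)=A^{-1}\Pi_X\big(\rho^{-1}B_{X,\xi,\eta}-2A^{-1}C_{X,\xi,\eta}\big)+2P_X^{G^{(1)}}\Big(X\big(-\rho X^\top C_{X,\xi,\eta}+\mathrm{sym}(\Omega_{X,\xi}\Omega_{X,\eta})\big)\Big)$$ and $$\begin{aligned}P_X^{G^{(2)}}\big(\Gamma_X^{(2)}(\xi,\eta)\big)={}&A^{-1}S_X\big(\rho^{-1}S_XB_{X,\xi,\eta}-D_{X,\xi,\eta}+AXJ\,\mathrm{sym}(\xi^\top\Pi_X\eta)\big)\\&+P_X^{G^{(2)}}\Big(X\big(-\rho\,\mathrm{sym}(\xi^\top\Pi_X\eta)+2\,\mathrm{sym}(\Omega_{X,\xi}\Omega_{X,\eta})\big)\Big).\end{aligned}$$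
   Context: Standing setting: $p\le n$ are positive integers; $A$ is a real symmetric invertible $n\times n$ matrix; $J$ is a real symmetric $p\times p$ matrix with $J^2=I_p$, whose numbers of positive and negative eigenvalues are at most those of $A$, respectively; $\rho>0$. $\mathrm{sym}(S)=(S+S^\top)/2$, and $\mathrm{Skew}(p)$ is the set of real skew-symmetric $p\times p$ matrices. $\mathcal{E}$ is the open submanifold of $\mathbb{R}^{n\times p}$ of all $X$ with $\det(X^\top X)\neq0$ and $\det(X^\top AX)\ne0$ (tangent spaces $\mathbb{R}^{n\times p}$). $\mathrm{iSt}_{A,J}(p,n)=\{X\in\mathbb{R}^{n\times p}\mid X^\top AX=J\}\subset\mathcal{E}$, with tangent space $T_X\mathrm{iSt}_{A,J}(p,n)=\{\xi\in\mathbb{R}^{n\times p}\mid\xi^\top AX+X^\top A\xi=0\}$. For $X\in\mathcal{E}$: $G_X^{(1)}=\frac1\rho AXX^\top A+(A-AXJX^\top A)^2$ and $G_X^{(2)}=\frac1\rho AXX^\top A+I_n-X(X^\top X)^{-1}X^\top$, both symmetric positive definite. For $i=1,2$, $\mathcal{E}$ is endowed with the Riemannian metric $\langle\xi,\eta\rangle_X=\mathrm{tr}(\xi^\top G_X^{(i)}\eta)$, with Levi-Civita connection $\bar\nabla$, and the Christoffel function is the bilinear map $\Gamma_X^{(i)}\colon\mathbb{R}^{n\times p}\times\mathbb{R}^{n\times p}\to\mathbb{R}^{n\times p}$ given by $\Gamma_X^{(i)}(\xi,\eta)=(\bar\nabla_{\bar U}\bar V)(X)-\mathrm{D}\bar V(X)[\xi]$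 for any smooth vector fields $\bar U,\bar V$ on $\mathcal{E}$ with $\bar U(X)=\xi$, $\bar V(X)=\eta$, where $\mathrm{D}\bar V(X)[\xi]$ is the ordinary directional derivative. $P_X^{G^{(i)}}\colon\mathbb{R}^{n\times p}\to T_X\mathrm{iSt}_{A,J}(p,n)$ is the orthogonal projection with respect to $\langle\cdot,\cdot\rangle_X$ defined by $G^{(i)}_X$; for both $i=1,2$ it is given by $P_X^{G^{(i)}}(Y)=Y-XJ\,\mathrm{sym}(X^\top AY)$. Notation: $M_X=(X^\top X)^{-1}$, $\Pi_X=I_n-XM_XX^\top$, $S_X=A-AXJX^\top A$, $B_{X,\xi,\eta}=\xi X^\top A\eta+\eta X^\top A\xi$, $C_{X,\xi,\eta}=\mathrm{sym}(A\,\mathrm{sym}(XJ\xi^\top)AS_X)\eta+\mathrm{sym}(A\,\mathrm{sym}(XJ\eta^\top)AS_X)\xi-\mathrm{sym}(AS_X\,\mathrm{sym}(\xi\eta^\top)A)XJ$, $D_{X,\xi,\eta}=\mathrm{sym}(XM_X\xi^\top)\eta+\mathrm{sym}(XM_X\eta^\top)\xi-\mathrm{sym}(\xi\eta^\top)XM_X$. *)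

(* Defs.v *)
From HB Require Import structures.
From mathcomp Require Import all_boot all_order all_algebra.
From mathcomp Require Import all_classical all_reals all_analysis.
From mathcomp Require Import polyrcf.

Set Implicit Arguments.
Unset Strict Implicit.
Unset Printing Implicit Defensive.

Import Order.TTheory GRing.Theory Num.Theory.
Import numFieldNormedType.Exports.

Local Open Scope classical_set_scope.
Local Open Scope ring_scope.

Section Calculus.
Variable R : realType.

(* For [E] open and [V] finite dimensional, differentiability at every point
   together with C^k directional derivatives in all fixed directions is the
   usual C^(k+1) on [E]. Functions are total, but only their values on the open
   set [E] matter. *)
Fixpoint Ck_on (V W : normedModType R) (E : set V) (k : nat) (f : V -> W)
    : Prop :=
  match k with
  | 0%N => forall x, E x -> {for x, continuous f}
  | k'.+1 => (forall x, E x -> differentiable f x) /\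
             (forall v : V, Ck_on E k' (fun x => 'D_v f x))
  end.

Definition smooth_on (V W : normedModType R) (E : set V) (f : V -> W) : Prop :=
  forall k, Ck_on E k f.

Variable V : normedModType R.

Definition lie_bracket (U W : V -> V) (x : V) : V :=
  'D_(U x) W x - 'D_(W x) U x.

(* [E] is an open subset of the vector space [V], so a vector field on [E] is a
   map [V -> V] considered on [E] only; [nabla U W] stands for the covariant
   derivative of [W] along [U]. *)
Record is_connection (E : set V) (nabla : (V -> V) -> (V -> V) -> (V -> V))
    : Prop := {
  connection_smooth : forall U W, smooth_on E U -> smooth_on E W ->
    smooth_on E (nabla U W);
  connection_addl : forall U1 U2 W,
    smooth_on E U1 -> smooth_on E U2 -> smooth_on E W ->
    forall x, E x ->
    nabla (fun y => U1 y + U2 y) W x = nabla U1 W x + nabla U2 W x;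
  connection_scalel : forall (f : V -> R) U W,
    smooth_on E f -> smooth_on E U -> smooth_on E W ->
    forall x, E x -> nabla (fun y => f y *: U y) W x = f x *: nabla U W x;
  connection_addr : forall U W1 W2,
    smooth_on E U -> smooth_on E W1 -> smooth_on E W2 ->
    forall x, E x ->
    nabla U (fun y => W1 y + W2 y) x = nabla U W1 x + nabla U W2 x;
  connection_leibniz : forall (f : V -> R) U W,
    smooth_on E f -> smooth_on E U -> smooth_on E W ->
    forall x, E x ->
    nabla U (fun y => f y *: W y) x = 'D_(U x) f x *: W x + f x *: nabla U W x
}.

Record is_levi_civita (E : set V) (g : V -> V -> V -> R)
    (nabla : (V -> V) -> (V -> V) -> (V -> V)) : Prop := {
  levi_civita_connection : is_connection E nabla;
  levi_civita_torsion_free : forall U W, smooth_on E U -> smooth_on E W ->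
    forall x, E x -> nabla U W x - nabla W U x = lie_bracket U W x;
  levi_civita_metric : forall U W Z,
    smooth_on E U -> smooth_on E W -> smooth_on E Z ->
    forall x, E x ->
    'D_(U x) (fun y => g y (W y) (Z y)) x =
      g x (nabla U W x) (Z x) + g x (W x) (nabla U Z x)
}.

Definition is_christoffel (E : set V)
    (nabla : (V -> V) -> (V -> V) -> (V -> V)) (Gamma : V -> V -> V -> V)
    : Prop :=
  forall x, E x ->
    bilinear_for *:%R *:%R (Gamma x) /\
    forall U W, smooth_on E U -> smooth_on E W ->
      Gamma x (U x) (W x) = nabla U W x - 'D_(U x) W x.

Definition is_orth_proj (g : V -> V -> R) (T : set V) (P : V -> V) : Prop :=
  forall y, T (P y) /\ forall z, T z -> g (y - P y) z = 0.

End Calculus.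

Section Eigenvalues.
Variables (R : realType) (m : nat).

(* Counted with algebraic multiplicity; [rootsR q] lists the distinct real
   roots of [q]. *)
Definition num_pos_eig (A : 'M[R]_m) : nat :=
  (\sum_(a <- rootsR (char_poly A) | (0 < a)%R) mup a (char_poly A))%N.

Definition num_neg_eig (A : 'M[R]_m) : nat :=
  (\sum_(a <- rootsR (char_poly A) | (a < 0)%R) mup a (char_poly A))%N.

End Eigenvalues.

Section Stiefel.
Variable R : realType.

Definition symm m (S : 'M[R]_m) : 'M[R]_m := 2^-1 *: (S + S^T).

Definition Skew m : set 'M[R]_m := [set S | S^T = - S].

Variables n p : nat.
Implicit Types (A : 'M[R]_n) (J : 'M[R]_p) (rho : R) (X xi eta : 'M[R]_(n, p)).

Definition ambient A : set 'M[R]_(n, p) :=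
  [set X | \det (X^T *m X) != 0 /\ \det (X^T *m A *m X) != 0].

Definition iSt A J : set 'M[R]_(n, p) := [set X | X^T *m A *m X = J].

Definition iSt_tangent A X : set 'M[R]_(n, p) :=
  [set xi | xi^T *m A *m X + X^T *m A *m xi = 0].

Definition MX X : 'M[R]_p := invmx (X^T *m X).

Definition PiX X : 'M[R]_n := 1%:M - X *m MX X *m X^T.

Definition SX A J X : 'M[R]_n := A - A *m X *m J *m X^T *m A.

Definition G1 A J rho X : 'M[R]_n :=
  rho^-1 *: (A *m X *m X^T *m A) + SX A J X *m SX A J X.

Definition G2 A rho X : 'M[R]_n :=
  rho^-1 *: (A *m X *m X^T *m A) + 1%:M - X *m invmx (X^T *m X) *m X^T.

Definition metric (G : 'M[R]_(n, p) -> 'M[R]_n) X xi eta : R :=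
  \tr (xi^T *m G X *m eta).

Definition BX A X xi eta : 'M[R]_(n, p) :=
  xi *m X^T *m A *m eta + eta *m X^T *m A *m xi.

Definition CX A J X xi eta : 'M[R]_(n, p) :=
  symm (A *m symm (X *m J *m xi^T) *m A *m SX A J X) *m eta
  + symm (A *m symm (X *m J *m eta^T) *m A *m SX A J X) *m xi
  - symm (A *m SX A J X *m symm (xi *m eta^T) *m A) *m X *m J.

Definition DX X xi eta : 'M[R]_(n, p) :=
  symm (X *m MX X *m xi^T) *m eta
  + symm (X *m MX X *m eta^T) *m xi
  - symm (xi *m eta^T) *m X *m MX X.

End Stiefel.

(* Main.v *)
Require Import Defs.
From HB Require Import structures.
From mathcomp Require Import all_boot all_order all_fingroup all_algebra.
From mathcomp Require Import all_classical all_reals all_analysis.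
From mathcomp Require Import ring lra.

Set Implicit Arguments.
Unset Strict Implicit.
Unset Printing Implicit Defensive.

Import Order.TTheory GRing.Theory Num.Theory.
Import numFieldNormedType.Exports.

Local Open Scope classical_set_scope.
Local Open Scope ring_scope.

(** On constant vector fields the Koszul formula expresses the Christoffel
function through the directional derivatives of the metric matrix [G], so that
[2 G Gamma(xi, eta) = dG(xi) eta + dG(eta) xi - K], where [K] collects the
derivative of [G] in the direction of the test vector ([koszul_cst],
[mulmx_christoffel]). For both metrics [dG(v)] is a combination of terms
[U v W + (U v W)^T], and cyclicity of the trace gives [K] termwise. For tangent
[xi] and [eta] this yields, with [T' = sym(xi^T A eta)],

  [G1 Gamma1 = rho^-1 (A B + A X T') - 2 C],
  [G2 Gamma2 = rho^-1 (A B + A X T') - Pi D - X M sym(xi^T Pi eta)]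

([G1_mul_christoffel], [G2_mul_christoffel]).

The metric matrices need not be inverted. On the manifold both satisfy
[G X = rho^-1 A X J], while [G1 A^-1 Pi v = S v] and [G2 A^-1 S v = Pi v], and
together with [X^T A B = 2 sym(Omega_xi Omega_eta)] these identities show that
[G] takes an explicit vector to the expressions above. As [G] is definite, this
vector is the Christoffel function ([christoffel1E], [christoffel2E]). It is the
sum of three parts: one in the range of [A^-1 Pi] or of [A^-1 S], one of the
form [X W], and [X J T'].

Finally, [G X = rho^-1 A X J] makes the vectors [X J S] with [S] symmetric
normal, whence [P(Y) = Y - X J sym(X^T A Y)] ([orth_projE]). The projection is
linear, fixes the first part, which [X^T A] kills, and kills the last one. What
remains is the asserted formula. *)

(** * Derivatives of matrix-valued maps *)

Section MatrixCalculus.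
Variables (R : realType) (V : normedModType R).
Implicit Types (x v : V).

Lemma is_derive_mxP m n (F : V -> 'M[R]_(m, n)) x v (dF : 'M[R]_(m, n)) :
  is_derive x v F dF <->
  forall i j, is_derive x v (fun y => F y i j) (dF i j).
Proof.
split=> [[dFx <-] i j|dF_ij].
  apply: DeriveDef; first exact: ((derivable_mxP F x v).1 dFx).
  by rewrite derive_mx// mxE.
have dFx : derivable F x v by apply/derivable_mxP => i j; case: (dF_ij i j).
apply: DeriveDef => //; rewrite derive_mx//.
by apply/matrixP => i j; rewrite mxE; case: (dF_ij i j).
Qed.

Lemma is_derive_big (I : Type) (r : seq I) (f : I -> V -> R) (df : I -> R) x v :
  (forall i, is_derive x v (f i) (df i)) ->
  is_derive x v (fun y => \sum_(i <- r) f i y) (\sum_(i <- r) df i).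
Proof.
move=> dfi; elim: r => [|i r IHr].
  rewrite big_nil; under eq_fun do rewrite big_nil.
  exact: is_derive_cst.
rewrite big_cons; under eq_fun do rewrite big_cons.
exact: is_deriveD.
Qed.

Lemma derivable_prod (I : Type) (r : seq I) (f : I -> V -> R) x v :
  (forall i, derivable (f i) x v) ->
  derivable (fun y => \prod_(i <- r) f i y) x v.
Proof.
move=> dfi; elim: r => [|i r IHr].
  under eq_fun do rewrite big_nil.
  exact: derivable_cst.
under eq_fun do rewrite big_cons.
exact: derivableM.
Qed.

Lemma is_derive_mulmx m n p (F : V -> 'M[R]_(m, n)) (G : V -> 'M[R]_(n, p))
    x v dF dG :
  is_derive x v F dF -> is_derive x v G dG ->
  is_derive x v (fun y => F y *m G y) (dF *m G x + F x *m dG).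
Proof.
move=> /is_derive_mxP dF_ij /is_derive_mxP dG_ij.
apply/is_derive_mxP => i j; rewrite !mxE -big_split/=.
under eq_fun do rewrite mxE.
apply: is_derive_big => k.
rewrite addrC [dF i k * _]mulrC.
exact: (is_deriveM (dF_ij i k) (dG_ij k j)).
Qed.

Lemma is_derive_mulmxl m n p (B : 'M[R]_(m, n)) (G : V -> 'M[R]_(n, p))
    x v dG :
  is_derive x v G dG -> is_derive x v (fun y => B *m G y) (B *m dG).
Proof.
move=> dGx; apply: is_derive_eq.
  exact: (is_derive_mulmx (is_derive_cst B x v) dGx).
by rewrite mul0mx add0r.
Qed.

Lemma is_derive_mulmxr m n p (B : 'M[R]_(n, p)) (F : V -> 'M[R]_(m, n))
    x v dF :
  is_derive x v F dF -> is_derive x v (fun y => F y *m B) (dF *m B).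
Proof.
move=> dFx; apply: is_derive_eq.
  exact: (is_derive_mulmx dFx (is_derive_cst B x v)).
by rewrite mulmx0 addr0.
Qed.

Lemma is_derive_trmx m n (F : V -> 'M[R]_(m, n)) x v dF :
  is_derive x v F dF -> is_derive x v (fun y => (F y)^T) dF^T.
Proof.
move=> /is_derive_mxP dF_ij; apply/is_derive_mxP => i j; rewrite mxE.
by under eq_fun do rewrite mxE.
Qed.

Lemma is_derive_mxtrace n (F : V -> 'M[R]_n) x v dF :
  is_derive x v F dF -> is_derive x v (fun y => \tr (F y)) (\tr dF).
Proof. by move=> /is_derive_mxP dF_ij; exact: is_derive_big. Qed.

(** Only derivability of the determinant is wanted: it makes the inverse
derivable through the adjugate formula, and the value of the derivative of the
inverse is then forced by differentiating a product that is constantly 1. *)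
Lemma derivable_det n (F : V -> 'M[R]_n) x v :
  derivable F x v -> derivable (fun y => \det (F y)) x v.
Proof.
move=> /derivable_mxP dF.
have dterm (s : 'S_n) :
    derivable (fun y => (-1) ^+ s * \prod_i F y i (s i)) x v.
  apply: (derivableM (derivable_cst _ _ _)).
  by apply: derivable_prod => i; exact: dF.
by have [] := is_derive_big (index_enum _) (fun s => derivableP (dterm s)).
Qed.

End MatrixCalculus.

Section Inverse.
Variables (R : realType) (n : nat).

Lemma derivable_adj (V : normedModType R) (F : V -> 'M[R]_n) x v :
  derivable F x v -> derivable (fun y => \adj (F y)) x v.
Proof.
move=> /derivable_mxP dF; apply/derivable_mxP => i j.
under eq_fun do rewrite mxE.
apply: (derivableM (derivable_cst _ _ _)); apply: derivable_det.
apply/derivable_mxP => k l; under eq_fun do rewrite !mxE.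
exact: dF.
Qed.

(** A function of one real variable that is derivable is continuous, so the
determinant stays nonzero; a directional derivative on a larger space gives no
such neighbourhood, which is why inverses are first treated on a line. *)
Lemma unitmx_near_line (F : R -> 'M[R]_n) (t : R) :
  F t \in unitmx -> derivable F t 1 -> \forall s \near t, F s \in unitmx.
Proof.
move=> Ft_unit /derivable_det/derivable1_diffP/differentiable_continuous.
move=> /cvgr_neq0; rewrite -unitfE -unitmxE => /(_ Ft_unit).
by apply: filterS => s; rewrite unitmxE unitfE.
Qed.

Lemma is_derive_invmx_line (F : R -> 'M[R]_n) (t : R) dF :
  F t \in unitmx -> is_derive t (1 : R) F dF ->
  is_derive t (1 : R) (fun s => invmx (F s)) (- (invmx (F t) *m dF *m invmx (F t))).
Proof.
move=> Ft_unit dFt; have [derF _] := dFt.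
have F_unit := unitmx_near_line Ft_unit derF.
have der_inv : derivable (fun s => invmx (F s)) t 1.
  have : derivable (fun s => (\det (F s))^-1 *: \adj (F s)) t 1.
    apply/derivable_mxP => i j; under eq_fun do rewrite mxE.
    apply: derivableM; last by move/derivable_mxP: (derivable_adj derF); apply.
    apply: derivableV; first by rewrite -unitfE -unitmxE.
    exact: derivable_det.
  apply: near_eq_derivable; apply: filterS F_unit => s Fs_unit.
  by rewrite /invmx Fs_unit.
apply: DeriveDef => //; set dN := 'D_1 _ t.
have /is_derive_mulmx/(_ dFt)[_] := derivableP der_inv; rewrite -/dN.
(* The product of the inverse with [F] is constant near [t], so the product
   rule determines [dN]. *)
rewrite (near_eq_derive (1 : R) (g := cst 1%:M)); last first.
  by apply: filterS F_unit => s Fs_unit; rewrite mulVmx.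
rewrite derive_cst => /esym/eqP; rewrite addr_eq0 => /eqP dNF.
by rewrite -[LHS](mulmxK Ft_unit) dNF mulNmx.
Qed.

(** A directional derivative is a derivative in one real variable; this
transfers what was shown on a line to an arbitrary domain. *)
Lemma is_derive_line (V W : normedModType R) (f : V -> W) x v df :
  is_derive x v f df <->
  is_derive (0 : R) (1 : R) (fun h : R => f (h *: v + x)) df.
Proof.
have deriveE : 'D_v f x = 'D_1 (fun h : R => f (h *: v + x)) 0.
  rewrite /derive; set q1 := (X in X @ _); set q2 := (X in _ = lim (X @ _)).
  suff -> : q1 = q2 by [].
  by apply/funext => h; rewrite /q1 /q2/= addr0 scale0r add0r [_%:A]mulr1.
split=> -[derf fE]; apply: DeriveDef.
- exact: (derivable1P f x v).1.
- by rewrite -deriveE.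
- exact: (derivable1P f x v).2.
- by rewrite deriveE.
Qed.

Lemma is_derive_invmx (V : normedModType R) (F : V -> 'M[R]_n) x v dF :
  F x \in unitmx -> is_derive x v F dF ->
  is_derive x v (fun y => invmx (F y)) (- (invmx (F x) *m dF *m invmx (F x))).
Proof.
move=> Fx_unit /is_derive_line dFx.
have F0 : F (0 *: v + x) = F x by rewrite scale0r add0r.
apply/is_derive_line; rewrite -[in _ *m _]F0.
by apply: is_derive_invmx_line dFx; rewrite F0.
Qed.

End Inverse.

(** * Trace pairing *)

Section TracePairing.
Variable R : realType.

Lemma mxtrace_pairD n p (z M N : 'M[R]_(n, p)) :
  \tr (z^T *m (M + N)) = \tr (z^T *m M) + \tr (z^T *m N).
Proof. by rewrite mulmxDr raddfD. Qed.

Lemma mxtrace_pairB n p (z M N : 'M[R]_(n, p)) :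
  \tr (z^T *m (M - N)) = \tr (z^T *m M) - \tr (z^T *m N).
Proof. by rewrite mulmxBr raddfB. Qed.

Lemma mxtrace_formD n p (u w : 'M[R]_(n, p)) (M N : 'M[R]_n) :
  \tr (u^T *m (M + N) *m w) = \tr (u^T *m M *m w) + \tr (u^T *m N *m w).
Proof. by rewrite mulmxDr mulmxDl raddfD. Qed.

Lemma mxtrace_formB n p (u w : 'M[R]_(n, p)) (M N : 'M[R]_n) :
  \tr (u^T *m (M - N) *m w) = \tr (u^T *m M *m w) - \tr (u^T *m N *m w).
Proof. by rewrite mulmxBr mulmxBl raddfB. Qed.

Lemma mxtrace_sqr m n (M : 'M[R]_(m, n)) :
  \tr (M^T *m M) = \sum_j \sum_i M i j ^+ 2.
Proof.
apply: eq_bigr => j _; rewrite mxE.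
by apply: eq_bigr => i _; rewrite mxE expr2.
Qed.

Lemma mxtrace_sqr_ge0 m n (M : 'M[R]_(m, n)) : 0 <= \tr (M^T *m M).
Proof.
by rewrite mxtrace_sqr; apply: sumr_ge0 => j _; apply: sumr_ge0 => i _;
  exact: sqr_ge0.
Qed.

Lemma mxtrace_sqr_eq0 m n (M : 'M[R]_(m, n)) : \tr (M^T *m M) = 0 -> M = 0.
Proof.
have sq_ge0 j : 0 <= \sum_i M i j ^+ 2.
  by apply: sumr_ge0 => i _; exact: sqr_ge0.
rewrite mxtrace_sqr => /psumr_eq0P colM0; apply/matrixP => i j; rewrite mxE.
have /psumr_eq0P colM0j := colM0 (fun j _ => sq_ge0 j) j isT.
by apply/eqP; rewrite -sqrf_eq0 colM0j// => k _; exact: sqr_ge0.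
Qed.

Lemma mxtrace_inj m n (M N : 'M[R]_(m, n)) :
  (forall Z : 'M[R]_(m, n), \tr (Z^T *m M) = \tr (Z^T *m N)) -> M = N.
Proof.
move=> MN; apply/eqP; rewrite -subr_eq0; apply/eqP/mxtrace_sqr_eq0.
by rewrite mulmxBr raddfB/= MN subrr.
Qed.

(** A definite metric is nondegenerate, so a vector is known once the metric
matrix has been applied to it. This allows a Christoffel function to be
identified without inverting the metric matrix. *)
Lemma metric_mulmx_inj n p (G : 'M[R]_(n, p) -> 'M[R]_n) (X M N : 'M[R]_(n, p)) :
  (forall z, metric G X z z = 0 -> z = 0) -> G X *m M = G X *m N -> M = N.
Proof.
move=> defG GMN; apply/eqP; rewrite -subr_eq0; apply/eqP/defG.
by rewrite /metric -mulmxA mulmxBr GMN subrr mulmx0 raddf0.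
Qed.

(** Moves the direction [zeta] out of a derivative of the form
[U zeta W + transpose]: each of the two terms is brought to the form
[tr (zeta^T K)] by cyclicity of the trace, after a transposition for the first
one. *)
Lemma mxtrace_symm_adjoint n p (U : 'M[R]_n) (W : 'M[R]_(p, n))
    (xi eta zeta : 'M[R]_(n, p)) :
  \tr (xi^T *m (U *m zeta *m W + (U *m zeta *m W)^T) *m eta) =
  \tr (zeta^T *m (U^T *m (xi *m eta^T + eta *m xi^T) *m W^T)).
Proof.
have cycle (u v : 'M[R]_(n, p)) :
    \tr (u^T *m (U *m zeta *m W)^T *m v) =
    \tr (zeta^T *m (U^T *m (v *m u^T) *m W^T)).
  rewrite !trmx_mul -!mulmxA [LHS]mxtrace_mulC -!mulmxA [LHS]mxtrace_mulC.
  by rewrite !mulmxA.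
rewrite !(mulmxDr, mulmxDl) !raddfD/=; congr (_ + _); last exact: cycle.
by rewrite -cycle -mxtrace_tr !trmx_mul !trmxK mulmxA.
Qed.

End TracePairing.

(** * The Koszul formula on constant fields *)

Section ConstantFields.
Variables (R : realType) (V : normedModType R).

Lemma smooth_on_cst (W : normedModType R) (E : set V) (w : W) :
  smooth_on E (cst w : V -> W).
Proof.
move=> k; elim: k w => [|k IHk] w; first by move=> x _; exact: cst_continuous.
split=> [x _|v]; first exact: differentiable_cst.
by rewrite (_ : (fun x => 'D_v (cst w) x) = cst 0) //; apply/funext => x;
  rewrite derive_cst.
Qed.

End ConstantFields.

Section ChristoffelMatrix.
Variables (R : realType) (n p : nat).
Variables (E : set 'M[R]_(n, p)) (G : 'M[R]_(n, p) -> 'M[R]_n).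
Variables (nabla : ('M[R]_(n, p) -> 'M[R]_(n, p)) ->
  ('M[R]_(n, p) -> 'M[R]_(n, p)) -> ('M[R]_(n, p) -> 'M[R]_(n, p))).
Variables (Gamma : 'M[R]_(n, p) -> 'M[R]_(n, p) -> 'M[R]_(n, p) -> 'M[R]_(n, p)).
Variables (X : 'M[R]_(n, p)) (dG : 'M[R]_(n, p) -> 'M[R]_n).
Hypotheses (lcG : is_levi_civita E (metric G) nabla).
Hypotheses (chG : is_christoffel E nabla Gamma) (EX : E X).
Hypotheses (symG : (G X)^T = G X).
Hypothesis (derG : forall v, is_derive X v G (dG v)).

Lemma metric_sym xi eta : metric G X xi eta = metric G X eta xi.
Proof. by rewrite /metric -mxtrace_tr !trmx_mul trmxK symG mulmxA. Qed.

(** Constant fields have vanishing brackets, so the Koszul formula keeps only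
its three derivative terms, and the Christoffel function at constant fields is
the covariant derivative itself. The identity combines metric compatibility in
its three cyclic forms; torsion-freeness cancels four of the six terms. *)
Lemma koszul_cst xi eta zeta :
  2 * metric G X (Gamma X xi eta) zeta =
    \tr (eta^T *m dG xi *m zeta) + \tr (xi^T *m dG eta *m zeta)
    - \tr (xi^T *m dG zeta *m eta).
Proof.
have smc w : smooth_on E (cst w : 'M[R]_(n, p) -> 'M[R]_(n, p)).
  exact: smooth_on_cst.
pose N u w : 'M[R]_(n, p) := nabla (cst u) (cst w) X.
have GammaE : Gamma X xi eta = N xi eta.
  have [_ /(_ _ _ (smc xi) (smc eta))] := chG EX.
  by rewrite derive_cst subr0.
have tors u w : N u w = N w u.
  have := levi_civita_torsion_free lcG (smc u) (smc w) EX.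
  by rewrite /lie_bracket !derive_cst subrr => /eqP; rewrite subr_eq0 => /eqP.
have compat u w z :
    \tr (w^T *m dG u *m z) = metric G X (N u w) z + metric G X w (N u z).
  rewrite -(levi_civita_metric lcG (smc u) (smc w) (smc z) EX).
  rewrite /metric /=; apply/esym.
  have [_ ->//] := is_derive_mxtrace
    (is_derive_mulmxr z (is_derive_mulmxl w^T (derG u))).
(* Torsion-freeness leaves only [N xi eta], [N xi zeta] and [N eta zeta], and
   the symmetry of the metric brings the terms in the last two to equal form. *)
rewrite GammaE !compat (tors eta xi) (tors zeta xi) (tors zeta eta).
rewrite (metric_sym eta) (metric_sym xi (N eta zeta)).
ring.
Qed.

(** The Koszul formula with the test vector stripped off: [K] is the adjoint
expression obtained from the third term, where the test vector is the direction
of differentiation. *)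
Lemma mulmx_christoffel xi eta K :
  (forall v, (dG v)^T = dG v) ->
  (forall zeta, \tr (xi^T *m dG zeta *m eta) = \tr (zeta^T *m K)) ->
  2 *: (G X *m Gamma X xi eta) = dG xi *m eta + dG eta *m xi - K.
Proof.
move=> symdG adjK; apply: mxtrace_inj => zeta.
rewrite -scalemxAr mxtraceZ mulmxA -/(metric G X zeta _) metric_sym koszul_cst.
rewrite adjK mulmxBr mulmxDr raddfB raddfD/=; congr (_ + _ - _).
  by rewrite -mxtrace_tr !trmx_mul trmxK symdG.
by rewrite -mxtrace_tr !trmx_mul trmxK symdG.
Qed.

End ChristoffelMatrix.

(** * Expansion of matrix products and symmetric parts *)

Section LinearExpansion.
Variable R : comUnitRingType.

Lemma addmxE m n (M N : 'M[R]_(m, n)) i j : (M + N) i j = M i j + N i j.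
Proof. by rewrite mxE. Qed.

Lemma oppmxE m n (M : 'M[R]_(m, n)) i j : (- M) i j = - M i j.
Proof. by rewrite mxE. Qed.

Lemma scalemxE m n a (M : 'M[R]_(m, n)) i j : (a *: M) i j = a * M i j.
Proof. by rewrite mxE. Qed.

Lemma zeromxE m n i j : (0 : 'M[R]_(m, n)) i j = 0.
Proof. by rewrite mxE. Qed.

Lemma trmxD m n (M N : 'M[R]_(m, n)) : (M + N)^T = M^T + N^T.
Proof. exact: raddfD. Qed.

Lemma trmxN m n (M : 'M[R]_(m, n)) : (- M)^T = - M^T.
Proof. exact: raddfN. Qed.

Lemma trmxZ m n a (M : 'M[R]_(m, n)) : (a *: M)^T = a *: M^T.
Proof. exact: linearZ. Qed.

(** With these rules both sides of an identity become combinations of the same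
left-associated monomials. *)
Definition mxexpand := (@mulmxDl R, @mulmxDr R, @mulNmx R, @mulmxN R,
  fun m n p a A B => esym (@scalemxAl R m n p a A B),
  fun m n p a A B => esym (@scalemxAr R m n p a A B), @mulmxA R,
  @mulmx1 R, @mul1mx R, @mulmx0 R, @mul0mx R).

Definition trexpand := (trmxD, trmxN, trmxZ, @trmx_mul R, @trmxK R, @trmx1 R).

Definition mxcoefE := (addmxE, oppmxE, scalemxE, zeromxE).

End LinearExpansion.

(** Compares two combinations of matrix monomials entrywise: the entry of each
monomial is an atom for the scalar field. *)
Ltac mxring := apply/matrixP => ? ?; rewrite !mxcoefE; by field.

Section Symm.
Variables (R : realType) (m : nat).
Implicit Types S T : 'M[R]_m.

Lemma trmx_symm S : (symm S)^T = symm S.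
Proof. by rewrite /symm !trexpand addrC. Qed.

Lemma symmD S T : symm (S + T) = symm S + symm T.
Proof. by rewrite /symm !trexpand; mxring. Qed.

Lemma symmZ a S : symm (a *: S) = a *: symm S.
Proof. by rewrite /symm !trexpand; mxring. Qed.

Lemma symm_id S : S^T = S -> symm S = S.
Proof. by move=> Ssym; rewrite /symm Ssym; mxring. Qed.

Lemma mxtrace_sym_skew S T : S^T = S -> T^T = - T -> \tr (S *m T) = 0.
Proof.
move=> Ssym Tskew; have : \tr (S *m T) = - \tr (S *m T).
  by rewrite -{1}mxtrace_tr trmx_mul Ssym Tskew mulNmx raddfN/= mxtrace_mulC.
lra.
Qed.

End Symm.

(** * Tangent vectors and orthogonal projections *)

Section IndefiniteStiefel.
Variables (R : realType) (n p : nat).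
Variables (A : 'M[R]_n) (J : 'M[R]_p) (X : 'M[R]_(n, p)).
Hypotheses (symA : A^T = A) (symJ : J^T = J) (J2 : J *m J = 1%:M).
Hypothesis (XiSt : iSt A J X).

Lemma iStE : X^T *m A *m X = J.
Proof. exact: XiSt. Qed.

Lemma iSt_mulmx_eq0 k (C : 'M[R]_(p, k)) : X *m C = 0 -> C = 0.
Proof. by move=> XC0; rewrite -[C]mul1mx -J2 -{2}iStE -!mulmxA XC0 !mulmx0. Qed.

(** [X] has a left inverse, [J X^T A], and over the reals an injective [X] has a
definite Gram matrix. *)
Lemma iSt_gram_unit : X^T *m X \in unitmx.
Proof.
rewrite -row_free_unit; apply: inj_row_free => v vG0.
suff : v^T = 0 by move=> /(congr1 trmx); rewrite trmxK trmx0.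
apply/iSt_mulmx_eq0/mxtrace_sqr_eq0.
by rewrite trmx_mul trmxK -mulmxA [X^T *m _]mulmxA mulmxA vG0 mul0mx raddf0.
Qed.

Lemma iSt_ambient : ambient A X.
Proof.
split; first by rewrite -unitfE -unitmxE iSt_gram_unit.
by rewrite iStE -unitfE -unitmxE; have [] := mulmx1_unit J2.
Qed.

Lemma trmx_MX : (MX X)^T = MX X.
Proof. by rewrite /MX trmx_inv trmx_mul trmxK. Qed.

Lemma trmx_PiX : (PiX X)^T = PiX X.
Proof. by rewrite /PiX !trexpand trmx_MX mulmxA. Qed.

Lemma PiX_mulX : PiX X *m X = 0.
Proof.
rewrite /PiX /MX !mxexpand -[_ *m X^T *m X]mulmxA.
by rewrite mulmxKV ?iSt_gram_unit// subrr.
Qed.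

Lemma trX_PiX : X^T *m PiX X = 0.
Proof. by apply: trmx_inj; rewrite trmx_mul trmxK trmx_PiX PiX_mulX trmx0. Qed.

Lemma PiX_idem : PiX X *m PiX X = PiX X.
Proof. by rewrite [in X in _ *m X]/PiX mulmxBr mulmx1 !mulmxA PiX_mulX !mul0mx subr0. Qed.

Lemma trmx_SX : (SX A J X)^T = SX A J X.
Proof. by rewrite /SX !trexpand symA symJ !mulmxA. Qed.

Lemma SX_mulX : SX A J X *m X = 0.
Proof.
have -> : SX A J X *m X = A *m X - A *m X *m J *m (X^T *m A *m X).
  by rewrite /SX !mxexpand.
by rewrite iStE -[_ *m J *m J]mulmxA J2 mulmx1 subrr.
Qed.

Lemma SX_mul m (v : 'M[R]_(n, m)) :
  SX A J X *m v = A *m v - A *m X *m J *m (X^T *m A *m v).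
Proof. by rewrite /SX mulmxBl !mulmxA. Qed.

Lemma SX_PiX : SX A J X *m PiX X = SX A J X.
Proof. by rewrite /PiX mulmxBr mulmx1 !mulmxA SX_mulX !mul0mx subr0. Qed.

Lemma PiX_SX : PiX X *m SX A J X = SX A J X.
Proof.
by apply: trmx_inj; rewrite trmx_mul trmx_PiX trmx_SX SX_PiX.
Qed.

Lemma iSt_tangentP xi :
  iSt_tangent A X xi <-> (X^T *m A *m xi)^T = - (X^T *m A *m xi).
Proof.
rewrite /iSt_tangent/= !trexpand symA mulmxA.
by split=> [/eqP|->]; [rewrite addr_eq0 => /eqP|rewrite addNr].
Qed.

Section Projection.
Variables (G : 'M[R]_(n, p) -> 'M[R]_n) (k : R) (P : 'M[R]_(n, p) -> 'M[R]_(n, p)).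
Hypotheses (symG : (G X)^T = G X).
Hypothesis (GX : G X *m X = k *: (A *m X *m J)).
Hypothesis (posG : forall z, metric G X z z = 0 -> z = 0).
Hypothesis (projP : is_orth_proj (metric G X) (iSt_tangent A X) P).

(** The normal space consists of the [X J S] with [S] symmetric: since [G X] is a
multiple of [A X J], pairing [X J S] with a tangent vector [z] gives a multiple
of the trace of the symmetric [S] against the skew [X^T A z]. Definiteness of
the metric makes the orthogonal projection unique. *)
Lemma orth_projE Y : P Y = Y - X *m J *m symm (X^T *m A *m Y).
Proof.
set S := symm _; set W := _ - _.
have symS : S^T = S by exact: trmx_symm.
have XAW : X^T *m A *m W = X^T *m A *m Y - S.
  by rewrite /W mulmxBr !mulmxA iStE J2 mul1mx.
have tanW : iSt_tangent A X W.
  apply/iSt_tangentP; rewrite XAW trmxD trmxN symS /S /symm; mxring.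
have normalW z : iSt_tangent A X z -> metric G X (Y - W) z = 0.
  move=> /iSt_tangentP tanz; rewrite /metric /W opprB addrC subrK !trmx_mul symS.
  have XG : X^T *m G X = k *: (J *m X^T *m A).
    by rewrite -symG -trmx_mul GX !trexpand symA symJ !mulmxA.
  rewrite symJ -!mulmxA [X^T *m _]mulmxA XG -scalemxAl -scalemxAr -scalemxAr.
  by rewrite mxtraceZ -!mulmxA [J *m (J *m _)]mulmxA J2 mul1mx mxtrace_sym_skew
    ?mulr0// mulmxA.
have [tanPY normalPY] := projP Y.
have tanD : iSt_tangent A X (P Y - W).
  have /iSt_tangentP skewPY := tanPY; have /iSt_tangentP skewW := tanW.
  apply/iSt_tangentP.
  by rewrite mulmxBr trmxD trmxN skewPY skewW opprB opprK addrC.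
(* Two candidates differ by a tangent vector orthogonal to itself. *)
apply/eqP; rewrite -subr_eq0; apply/eqP/posG.
rewrite (_ : metric G X _ _ = metric G X (Y - W) (P Y - W)
  - metric G X (Y - P Y) (P Y - W)).
  by rewrite normalW// normalPY// subrr.
rewrite /metric -raddfB/= -mulmxBl -mulmxBl -raddfB/=.
by congr (\tr (_^T *m _ *m _)); mxring.
Qed.

Lemma orth_projD Y Z : P (Y + Z) = P Y + P Z.
Proof. by rewrite !orth_projE mulmxDr symmD mulmxDr opprD addrACA. Qed.

Lemma orth_projZ a Y : P (a *: Y) = a *: P Y.
Proof. by rewrite !orth_projE -[in symm _]scalemxAr symmZ -[in LHS]scalemxAr scalerBr. Qed.

Lemma orth_proj_id Y : X^T *m A *m Y = 0 -> P Y = Y.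
Proof.
by move=> XAY0; rewrite orth_projE XAY0 /symm trmx0 addr0 scaler0 mulmx0 subr0.
Qed.

Lemma orth_proj_normal T : T^T = T -> P (X *m J *m T) = 0.
Proof.
move=> symT; rewrite orth_projE (_ : X^T *m A *m (X *m J *m T) = T).
  by rewrite symm_id// subrr.
by rewrite !mulmxA iStE J2 mul1mx.
Qed.

End Projection.
End IndefiniteStiefel.

(** * Koszul terms of symmetrized sandwiches *)

Section Sandwich.
Variables (R : realType) (n p : nat).
Implicit Types (U : 'M[R]_n) (W : 'M[R]_(p, n)) (v xi eta zeta : 'M[R]_(n, p)).

(** The derivatives of both metric matrices are combinations of such maps, linear
in [v] and symmetric, for which the Koszul formula can be evaluated termwise. *)
Definition sandwich U W v : 'M[R]_n := U *m v *m W + (U *m v *m W)^T.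

Definition sandwich_adj U W xi eta : 'M[R]_(n, p) :=
  U^T *m (xi *m eta^T + eta *m xi^T) *m W^T.

Lemma trmx_sandwich U W v : (sandwich U W v)^T = sandwich U W v.
Proof. by rewrite /sandwich trmxD trmxK addrC. Qed.

Lemma sandwich_adjP U W xi eta zeta :
  \tr (xi^T *m sandwich U W zeta *m eta) = \tr (zeta^T *m sandwich_adj U W xi eta).
Proof. exact: mxtrace_symm_adjoint. Qed.

(** The contribution of one sandwich to twice the metric matrix applied to the
Christoffel function. *)
Definition koszul_term U W xi eta : 'M[R]_(n, p) :=
  sandwich U W xi *m eta + sandwich U W eta *m xi - sandwich_adj U W xi eta.

End Sandwich.

Section KoszulTerms.
Variables (R : realType) (n p : nat).
Variables (A : 'M[R]_n) (J : 'M[R]_p) (X xi eta : 'M[R]_(n, p)).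
Hypotheses (symA : A^T = A) (symJ : J^T = J).

(** Tangency turns [eta^T A X] into [- X^T A eta], so the adjoint terms double the
terms that make up [BX]. *)
Lemma koszul_term_A k :
  iSt_tangent A X xi -> iSt_tangent A X eta ->
  koszul_term A (k *: (X^T *m A)) xi eta =
    2 *: (k *: (A *m BX A X xi eta + A *m X *m symm (xi^T *m A *m eta))).
Proof.
move=> /(iSt_tangentP _ symA) skew_xi /(iSt_tangentP _ symA) skew_eta.
have xiAX : xi^T *m A *m X = - (X^T *m A *m xi).
  by rewrite -skew_xi !trmx_mul trmxK symA mulmxA.
have etaAX : eta^T *m A *m X = - (X^T *m A *m eta).
  by rewrite -skew_eta !trmx_mul trmxK symA mulmxA.
have skew_adj (u w : 'M[R]_(n, p)) : u^T *m A *m X = - (X^T *m A *m u) ->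
    A *m w *m u^T *m A *m X = - (A *m w *m X^T *m A *m u).
  by move=> uAX; rewrite -!mulmxA [u^T *m (A *m X)]mulmxA uAX !mulmxN !mulmxA.
rewrite /koszul_term /sandwich /sandwich_adj /symm /BX.
rewrite !trexpand symA !mxexpand (skew_adj _ xi etaAX) (skew_adj _ eta xiAX).
mxring.
Qed.

(** The two sandwiches are those occurring in the derivative of the square of
[S]; for [S] equal to [SX] the right-hand side is four times [CX]. *)
Lemma koszul_term_S S : S^T = S ->
  koszul_term A (J *m X^T *m A *m S) xi eta
  + koszul_term (S *m A) (J *m X^T *m A) xi eta =
  4 *: (symm (A *m symm (X *m J *m xi^T) *m A *m S) *m eta
  + symm (A *m symm (X *m J *m eta^T) *m A *m S) *m xi
  - symm (A *m S *m symm (xi *m eta^T) *m A) *m X *m J).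
Proof.
move=> symS; rewrite /koszul_term /sandwich /sandwich_adj /symm.
rewrite !trexpand symS symA symJ !mxexpand; mxring.
Qed.

(** Applied with [M] and [Q] equal to [MX] and [PiX]: the terms carrying [Q] on the
left form [Q] times [DX], and the two where [X] comes first give the last summand. *)
Lemma koszul_term_Pi M Q : M^T = M -> Q^T = Q -> Q *m X = 0 ->
  koszul_term Q (M *m X^T) xi eta = 
  2 *: (Q *m (symm (X *m M *m xi^T) *m eta + symm (X *m M *m eta^T) *m xi
  - symm (xi *m eta^T) *m X *m M) + X *m M *m symm (xi^T *m Q *m eta)).
Proof.
move=> symM symQ QX0; rewrite /koszul_term /sandwich /sandwich_adj /symm.
rewrite !trexpand symM symQ !mxexpand QX0 !mul0mx; mxring.
Qed.
End KoszulTerms.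

(** * Derivatives of the two metric matrices *)

Section MetricDerivatives.
Variables (R : realType) (n p : nat).
Variables (A : 'M[R]_n) (J : 'M[R]_p) (rho : R) (X : 'M[R]_(n, p)).
Hypotheses (symA : A^T = A) (symJ : J^T = J).

Lemma is_derive_AXXA k v :
  is_derive X v (fun Y => k *: (A *m Y *m Y^T *m A))
    (sandwich A (k *: (X^T *m A)) v).
Proof.
have dX := is_derive_id X v.
have dAXXA := is_derive_mulmxr A
  (is_derive_mulmx (is_derive_mulmxl A dX) (is_derive_trmx dX)).
apply: (is_derive_eq (is_deriveZ k dAXXA)).
rewrite /sandwich !trexpand symA !mxexpand; mxring.
Qed.

Lemma is_derive_SX v :
  is_derive X v (SX A J) (- (A *m (v *m J *m X^T + X *m J *m v^T) *m A)).
Proof.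
have dX := is_derive_id X v.
have dAXJ := is_derive_mulmxr J (is_derive_mulmxl A dX).
have dAXJXA := is_derive_mulmxr A (is_derive_mulmx dAXJ (is_derive_trmx dX)).
apply: (is_derive_eq (is_deriveB (is_derive_cst A X v) dAXJXA)).
rewrite sub0r !mxexpand; mxring.
Qed.

Lemma is_derive_G1 v :
  is_derive X v (G1 A J rho)
    (sandwich A (rho^-1 *: (X^T *m A)) v
     - (sandwich A (J *m X^T *m A *m SX A J X) v
        + sandwich (SX A J X *m A) (J *m X^T *m A) v)).
Proof.
have symS := trmx_SX X symA symJ.
have dS := is_derive_SX v.
apply: (is_derive_eq (is_deriveD (is_derive_AXXA rho^-1 v) (is_derive_mulmx dS dS))).
(* Kept abstract, since unfolding [SX] would only multiply the monomials. *)
congr (_ + _); move: (SX A J X) symS => S symS.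
rewrite /sandwich !trexpand symA symJ symS !mxexpand; mxring.
Qed.

Hypothesis gram_unit : X^T *m X \in unitmx.

(** The inverse Gram matrix contributes [X M X^T v M X^T] and its transpose, which
turn [v M X^T] and its transpose into [PiX v M X^T] and its transpose. *)
Lemma is_derive_PiX v :
  is_derive X v (fun Y => 1%:M - Y *m invmx (Y^T *m Y) *m Y^T)
    (- sandwich (PiX X) (MX X *m X^T) v).
Proof.
have dX := is_derive_id X v; have dXT := is_derive_trmx dX.
have dM := is_derive_invmx (F := fun Y => Y^T *m Y) gram_unit
  (is_derive_mulmx dXT dX).
have dXMX := is_derive_mulmx (is_derive_mulmx dX dM) dXT.
apply: (is_derive_eq (is_deriveB (is_derive_cst 1%:M X v) dXMX)).
have symM := trmx_MX X; rewrite /sandwich !trmx_mul trmxK trmx_PiX symM /PiX.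
rewrite -/(MX X); move: (MX X) symM => M symM.
rewrite sub0r !mxexpand; mxring.
Qed.

Lemma is_derive_G2 v :
  is_derive X v (G2 A rho)
    (sandwich A (rho^-1 *: (X^T *m A)) v - sandwich (PiX X) (MX X *m X^T) v).
Proof.
rewrite (_ : G2 A rho = (fun Y => rho^-1 *: (A *m Y *m Y^T *m A))
  + (fun Y => 1%:M - Y *m invmx (Y^T *m Y) *m Y^T)).
  exact: is_deriveD (is_derive_AXXA rho^-1 v) (is_derive_PiX v).
by apply/funext => Y; rewrite /G2 -addrA.
Qed.

End MetricDerivatives.

(** * The metric matrices at a point of the manifold *)

Section StiefelMetrics.
Variables (R : realType) (n p : nat).
Variables (A : 'M[R]_n) (J : 'M[R]_p) (rho : R) (X : 'M[R]_(n, p)).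
Hypotheses (symA : A^T = A) (unitA : A \in unitmx).
Hypotheses (symJ : J^T = J) (J2 : J *m J = 1%:M) (rho_gt0 : 0 < rho).
Hypothesis (XiSt : iSt A J X).

Let symS := trmx_SX X symA symJ.
Let SX0 := SX_mulX J2 XiSt.
Let PiX0 := PiX_mulX J2 XiSt.
Let XPi0 := trX_PiX J2 XiSt.

Lemma trmx_AXXA : (A *m X *m X^T *m A)^T = A *m X *m X^T *m A.
Proof. by rewrite !trmx_mul trmxK symA !mulmxA. Qed.

Lemma trmx_G1 : (G1 A J rho X)^T = G1 A J rho X.
Proof. by rewrite /G1 trmxD trmxZ trmx_AXXA trmx_mul symS. Qed.

Lemma G2E : G2 A rho X = rho^-1 *: (A *m X *m X^T *m A) + PiX X.
Proof. by rewrite /G2 -addrA. Qed.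

Lemma trmx_G2 : (G2 A rho X)^T = G2 A rho X.
Proof. by rewrite G2E trmxD trmxZ trmx_AXXA trmx_PiX. Qed.

Lemma AXXA_mulX : A *m X *m X^T *m A *m X = A *m X *m J.
Proof. by rewrite -2!mulmxA [X^T *m _]mulmxA (iStE XiSt). Qed.

Lemma G1_mulX : G1 A J rho X *m X = rho^-1 *: (A *m X *m J).
Proof.
rewrite /G1 mulmxDl -scalemxAl AXXA_mulX -[_ *m SX A J X *m _]mulmxA SX0.
by rewrite mulmx0 addr0.
Qed.

Lemma G2_mulX : G2 A rho X *m X = rho^-1 *: (A *m X *m J).
Proof. by rewrite G2E mulmxDl -scalemxAl AXXA_mulX PiX0 addr0. Qed.

(** This part of both metrics is [rho^-1] times the squared norm of [X^T A z]; each
metric is the sum of it and a semidefinite form that vanishes on the multiples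
of [X]. *)
Lemma AXXA_form_ge0 m (z : 'M[R]_(n, m)) :
  0 <= \tr (z^T *m (rho^-1 *: (A *m X *m X^T *m A)) *m z).
Proof.
rewrite -scalemxAr -scalemxAl mxtraceZ; apply: mulr_ge0.
  by rewrite invr_ge0 ltW.
have -> : z^T *m (A *m X *m X^T *m A) *m z = (X^T *m A *m z)^T *m (X^T *m A *m z).
  by rewrite !trmx_mul trmxK symA !mulmxA.
exact: mxtrace_sqr_ge0.
Qed.

Lemma AXXA_form_eq0 m (z : 'M[R]_(n, m)) :
  \tr (z^T *m (rho^-1 *: (A *m X *m X^T *m A)) *m z) = 0 -> X^T *m A *m z = 0.
Proof.
rewrite -scalemxAr -scalemxAl mxtraceZ => /eqP.
rewrite mulf_eq0 invr_eq0 gt_eqF//= => /eqP trz0; apply: mxtrace_sqr_eq0.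
by rewrite !trmx_mul trmxK symA !mulmxA -trz0 !mulmxA.
Qed.

(** If [X^T A z] vanishes then [SX z] is [A z], and [A] is invertible. *)
Lemma G1_definite z : metric (G1 A J rho) X z z = 0 -> z = 0.
Proof.
rewrite /metric /G1 mulmxDr mulmxDl raddfD/= => /eqP.
have trSS : \tr (z^T *m (SX A J X *m SX A J X) *m z) =
    \tr ((SX A J X *m z)^T *m (SX A J X *m z)).
  by rewrite trmx_mul symS !mulmxA.
rewrite trSS paddr_eq0 ?AXXA_form_ge0 ?mxtrace_sqr_ge0//.
move=> /andP[/eqP/AXXA_form_eq0 XAz0 /eqP/mxtrace_sqr_eq0].
rewrite /SX mulmxBl -!mulmxA [X^T *m _]mulmxA XAz0 !mulmx0 subr0 => Az0.
by rewrite -[z](mulKmx unitA) Az0 mulmx0.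
Qed.

(** If [PiX z] vanishes then [z] is [X C] for some [C], and then [X^T A z] is [J C]. *)
Lemma G2_definite z : metric (G2 A rho) X z z = 0 -> z = 0.
Proof.
rewrite /metric G2E mulmxDr mulmxDl raddfD/= => /eqP.
have trPi : \tr (z^T *m PiX X *m z) = \tr ((PiX X *m z)^T *m (PiX X *m z)).
  by rewrite -{1}(PiX_idem J2 XiSt) trmx_mul trmx_PiX !mulmxA.
rewrite trPi paddr_eq0 ?AXXA_form_ge0 ?mxtrace_sqr_ge0//.
move=> /andP[/eqP/AXXA_form_eq0 XAz0 /eqP/mxtrace_sqr_eq0].
rewrite /PiX mulmxBl mul1mx -!mulmxA => /eqP; rewrite subr_eq0 => /eqP.
set C := (MX X *m _) => zX.
have JC0 : J *m C = 0 by rewrite -(iStE XiSt) -mulmxA -zX.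
by rewrite zX -[C]mul1mx -J2 -mulmxA JC0 !mulmx0.
Qed.

Lemma trX_A_invA_PiX m (v : 'M[R]_(n, m)) :
  X^T *m A *m (invmx A *m PiX X *m v) = 0.
Proof. by rewrite -!mulmxA mulKVmx// mulmxA XPi0 mul0mx. Qed.

(** On vectors killed by [X^T A] the metric is the square of [SX], and
[SX A^-1 PiX] is [PiX] because [X^T PiX] vanishes. *)
Lemma G1_mul_invA_PiX m (v : 'M[R]_(n, m)) :
  G1 A J rho X *m (invmx A *m PiX X *m v) = SX A J X *m v.
Proof.
rewrite /G1 mulmxDl -scalemxAl -[_ *m X^T *m A]mulmxA -[A *m X *m _ *m _]mulmxA.
rewrite trX_A_invA_PiX mulmx0 scaler0 add0r -mulmxA.
suff -> : SX A J X *m (invmx A *m PiX X *m v) = PiX X *m v.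
  by rewrite mulmxA (SX_PiX J2 XiSt).
rewrite /SX mulmxBl -!mulmxA mulKVmx// [X^T *m _]mulmxA XPi0 mul0mx !mulmx0.
by rewrite subr0.
Qed.

Lemma trX_A_invA_SX m (v : 'M[R]_(n, m)) :
  X^T *m A *m (invmx A *m SX A J X *m v) = 0.
Proof.
rewrite -!mulmxA mulKVmx// mulmxA.
have -> : X^T *m SX A J X = (SX A J X *m X)^T by rewrite trmx_mul symS.
by rewrite SX0 trmx0 mul0mx.
Qed.

(** [A^-1 SX] differs from the identity by a multiple [X C], which [PiX] kills, and
its range is killed by [X^T A]. *)
Lemma G2_mul_invA_SX m (v : 'M[R]_(n, m)) :
  G2 A rho X *m (invmx A *m SX A J X *m v) = PiX X *m v.
Proof.
rewrite G2E mulmxDl -scalemxAl -[_ *m X^T *m A]mulmxA -[A *m X *m _ *m _]mulmxA.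
rewrite trX_A_invA_SX mulmx0 scaler0 add0r.
have -> : invmx A *m SX A J X *m v = v - X *m (J *m X^T *m A *m v).
  by rewrite /SX mulmxBr mulmxBl mulVmx// mul1mx !mulmxA mulVmx// mul1mx.
by rewrite mulmxBr [PiX X *m (X *m _)]mulmxA PiX0 mul0mx subr0.
Qed.

(** Both factors are skew, so the transpose of their product is the product in
the other order, which is the second summand of [BX]. *)
Lemma trX_A_BX xi eta :
  iSt_tangent A X xi -> iSt_tangent A X eta ->
  X^T *m A *m BX A X xi eta =
    2 *: symm ((X^T *m A *m xi) *m (X^T *m A *m eta)).
Proof.
move=> /(iSt_tangentP _ symA) skew_xi /(iSt_tangentP _ symA) skew_eta.
rewrite /symm [X in _ + X]trmx_mul skew_xi skew_eta mulNmx mulmxN opprK.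
by rewrite scalerA mulfV ?scale1r ?pnatr_eq0// /BX mulmxDr !mulmxA.
Qed.

End StiefelMetrics.

(** * The two Christoffel functions *)

Section Christoffel.
Variables (R : realType) (n p : nat).
Variables (A : 'M[R]_n) (J : 'M[R]_p) (rho : R) (X xi eta : 'M[R]_(n, p)).
Variables (nabla : ('M[R]_(n, p) -> 'M[R]_(n, p)) ->
  ('M[R]_(n, p) -> 'M[R]_(n, p)) -> ('M[R]_(n, p) -> 'M[R]_(n, p))).
Variables (Gamma : 'M[R]_(n, p) -> 'M[R]_(n, p) -> 'M[R]_(n, p) -> 'M[R]_(n, p)).
Hypotheses (symA : A^T = A) (unitA : A \in unitmx).
Hypotheses (symJ : J^T = J) (J2 : J *m J = 1%:M) (rho_gt0 : 0 < rho).
Hypothesis (XiSt : iSt A J X).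
Hypotheses (tan_xi : iSt_tangent A X xi) (tan_eta : iSt_tangent A X eta).
Hypothesis (christoffelG : is_christoffel (@ambient R n p A) nabla Gamma).

Let ambX := iSt_ambient J2 XiSt.
Let scale2_inj (M N : 'M[R]_(n, p)) : 2 *: M = 2 *: N -> M = N.
Proof. by apply: scalerI; rewrite pnatr_eq0. Qed.

Lemma G1_mul_christoffel :
  is_levi_civita (@ambient R n p A) (metric (G1 A J rho)) nabla ->
  G1 A J rho X *m Gamma X xi eta =
    rho^-1 *: (A *m BX A X xi eta + A *m X *m symm (xi^T *m A *m eta))
    - 2 *: CX A J X xi eta.
Proof.
move=> lcG; apply: scale2_inj.
have symS := trmx_SX X symA symJ.
pose K U W := sandwich_adj U W xi eta.
rewrite (mulmx_christoffel lcG christoffelG ambX (trmx_G1 _ _ symA symJ)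
  (is_derive_G1 rho X symA symJ)
  (K := K A (rho^-1 *: (X^T *m A)) - (K A (J *m X^T *m A *m SX A J X)
        + K (SX A J X *m A) (J *m X^T *m A)))).
- rewrite scalerBr -(koszul_term_A symA _ tan_xi tan_eta) scalerA -natrM.
  rewrite -(koszul_term_S X xi eta symA symJ symS) /koszul_term.
  rewrite !(mulmxDl, mulNmx); mxring.
- by move=> v; rewrite trmxD trmx_sandwich trmxN trmxD !trmx_sandwich.
- move=> zeta; rewrite mxtrace_formB sandwich_adjP mxtrace_formD.
  by rewrite !sandwich_adjP mxtrace_pairB mxtrace_pairD.
Qed.

Lemma G2_mul_christoffel :
  is_levi_civita (@ambient R n p A) (metric (G2 A rho)) nabla ->
  G2 A rho X *m Gamma X xi eta =
    rho^-1 *: (A *m BX A X xi eta + A *m X *m symm (xi^T *m A *m eta))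
    - (PiX X *m DX X xi eta + X *m MX X *m symm (xi^T *m PiX X *m eta)).
Proof.
move=> lcG; apply: scale2_inj.
pose K U W := sandwich_adj U W xi eta.
rewrite (mulmx_christoffel lcG christoffelG ambX (trmx_G2 _ _ symA)
  (is_derive_G2 rho symA (iSt_gram_unit J2 XiSt))
  (K := K A (rho^-1 *: (X^T *m A)) - K (PiX X) (MX X *m X^T))).
- rewrite scalerBr -(koszul_term_A symA _ tan_xi tan_eta).
  rewrite -(koszul_term_Pi _ _ (trmx_MX X) (trmx_PiX X) (PiX_mulX J2 XiSt)).
  rewrite /koszul_term !(mulmxDl, mulNmx); mxring.
- by move=> v; rewrite trmxD trmx_sandwich trmxN trmx_sandwich.
- by move=> zeta; rewrite mxtrace_formB !sandwich_adjP mxtrace_pairB.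
Qed.

(** Both sides agree after multiplication by the metric matrix. The last summand is
normal, and the first is tangent. *)
Lemma christoffel1E :
  is_levi_civita (@ambient R n p A) (metric (G1 A J rho)) nabla ->
  Gamma X xi eta =
    invmx A *m PiX X *m (rho^-1 *: BX A X xi eta
                         - 2 *: (invmx A *m CX A J X xi eta))
    + 2 *: (X *m (- (rho *: (X^T *m CX A J X xi eta))
                  + symm ((X^T *m A *m xi) *m (X^T *m A *m eta))))
    + X *m J *m symm (xi^T *m A *m eta).
Proof.
move=> /G1_mul_christoffel GGamma.
apply: (metric_mulmx_inj (G := G1 A J rho) (X := X)
  (fun z => G1_definite symA unitA symJ rho_gt0 (z:=z))).
have := trX_A_BX symA tan_xi tan_eta; rewrite {}GGamma.
move: (BX A X xi eta) (CX A J X xi eta) => B C.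
move: (symm _) (symm (_ *m (X^T *m A *m eta))) => T Omega2 XAB.
rewrite 2!mulmxDr (G1_mul_invA_PiX _ unitA J2 XiSt) -scalemxAr.
rewrite !mulmxA (G1_mulX _ J2 XiSt) SX_mul [X^T *m A *m _]mulmxBr -!scalemxAr XAB.
rewrite !mxexpand (mulmxV unitA) mul1mx (mulmxK unitA).
rewrite -[A *m X *m J *m J]mulmxA J2 mulmx1.
by apply/matrixP => i j; rewrite !mxcoefE; field; rewrite gt_eqF.
Qed.

(** The summand [- X M sym (xi^T Pi eta)] left by the Koszul formula is the image
of a tangent part plus a multiple of [X], because
[Pi A X J - A X J = - X M]. *)
Lemma christoffel2E :
  is_levi_civita (@ambient R n p A) (metric (G2 A rho)) nabla ->
  Gamma X xi eta =
    invmx A *m SX A J X *m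
      (rho^-1 *: (SX A J X *m BX A X xi eta) - DX X xi eta
       + A *m X *m J *m symm (xi^T *m PiX X *m eta))
    + X *m (- (rho *: symm (xi^T *m PiX X *m eta))
            + 2 *: symm ((X^T *m A *m xi) *m (X^T *m A *m eta)))
    + X *m J *m symm (xi^T *m A *m eta).
Proof.
move=> /G2_mul_christoffel GGamma.
apply: (metric_mulmx_inj (G := G2 A rho) (X := X)
  (fun z => G2_definite symA J2 rho_gt0 XiSt (z:=z))).
have := trX_A_BX symA tan_xi tan_eta; rewrite {}GGamma.
move: (BX A X xi eta) (DX X xi eta) => B D XAB.
rewrite [RHS]mulmxDr [G2 A rho X *m (_ + _)]mulmxDr.
rewrite (G2_mul_invA_SX _ symA unitA symJ J2 XiSt).
rewrite [PiX X *m (_ + _)]mulmxDr [PiX X *m (_ - D)]mulmxDr mulmxN.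
rewrite -[PiX X *m (_ *: _)]scalemxAr [PiX X *m (SX A J X *m _)]mulmxA.
rewrite (PiX_SX symA symJ J2 XiSt) SX_mul XAB.
have -> (W : 'M[R]_p) : PiX X *m (A *m X *m J *m W) =
    A *m X *m J *m W - X *m MX X *m W.
  rewrite /PiX mulmxBl mul1mx !mulmxA -[_ *m X^T *m A]mulmxA.
  rewrite -[_ *m (X^T *m A) *m X]mulmxA (iStE XiSt) -[_ *m J *m J]mulmxA J2.
  by rewrite mulmx1.
move: (PiX X *m D) (MX X) => PiD M.
move: (symm _) (symm (_ *m PiX X *m _)) (symm (_ *m (X^T *m A *m eta))).
move=> T' T Omega2.
rewrite !mulmxA (G2_mulX _ J2 XiSt) !mxexpand.
rewrite -[A *m X *m J *m J]mulmxA J2 mulmx1.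
by apply/matrixP => i j; rewrite !mxcoefE; field; rewrite gt_eqF.
Qed.

End Christoffel.

Theorem lemma4p2 (R : realType) (n p : nat)
    (A : 'M[R]_n) (J : 'M[R]_p) (rho : R)
    (nabla1 nabla2 : ('M[R]_(n, p) -> 'M[R]_(n, p)) ->
      ('M[R]_(n, p) -> 'M[R]_(n, p)) -> ('M[R]_(n, p) -> 'M[R]_(n, p)))
    (Gamma1 Gamma2 :
      'M[R]_(n, p) -> 'M[R]_(n, p) -> 'M[R]_(n, p) -> 'M[R]_(n, p))
    (X xi eta : 'M[R]_(n, p))
    (P1 P2 : 'M[R]_(n, p) -> 'M[R]_(n, p)) :
  (0 < p)%N -> (p <= n)%N ->
  A^T = A -> A \in unitmx ->
  J^T = J -> J *m J = 1%:M ->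
  (num_pos_eig J <= num_pos_eig A)%N -> (num_neg_eig J <= num_neg_eig A)%N ->
  0 < rho ->
  is_levi_civita (@ambient R n p A) (metric (G1 A J rho)) nabla1 ->
  is_levi_civita (@ambient R n p A) (metric (G2 A rho)) nabla2 ->
  is_christoffel (@ambient R n p A) nabla1 Gamma1 ->
  is_christoffel (@ambient R n p A) nabla2 Gamma2 ->
  iSt A J X -> iSt_tangent A X xi -> iSt_tangent A X eta ->
  is_orth_proj (metric (G1 A J rho) X) (iSt_tangent A X) P1 ->
  is_orth_proj (metric (G2 A rho) X) (iSt_tangent A X) P2 ->
  let Omega_xi := X^T *m A *m xi in
  let Omega_eta := X^T *m A *m eta in
  let B := BX A X xi eta in
  let C := CX A J X xi eta in
  let D := DX X xi eta in
  [/\ Skew Omega_xi, Skew Omega_eta,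
      P1 (Gamma1 X xi eta) =
        invmx A *m PiX X *m (rho^-1 *: B - 2 *: (invmx A *m C))
        + 2 *: P1 (X *m (- (rho *: (X^T *m C)) + symm (Omega_xi *m Omega_eta)))
    & P2 (Gamma2 X xi eta) =
        invmx A *m SX A J X *m
          (rho^-1 *: (SX A J X *m B) - D
           + A *m X *m J *m symm (xi^T *m PiX X *m eta))
        + P2 (X *m (- (rho *: symm (xi^T *m PiX X *m eta))
                    + 2 *: symm (Omega_xi *m Omega_eta)))].
Proof.
move=> _ _ symA unitA symJ J2 _ _ rho_gt0 lc1 lc2 ch1 ch2 XiSt tan_xi tan_eta.
move=> proj1 proj2 Omega_xi Omega_eta B C D.
have sym1 := trmx_G1 rho X symA symJ; have sym2 := trmx_G2 rho X symA.
have GX1 := G1_mulX rho J2 XiSt; have GX2 := G2_mulX rho J2 XiSt.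
have def1 := fun z => G1_definite symA unitA symJ rho_gt0 (z := z) (X := X).
have def2 := fun z => G2_definite symA J2 rho_gt0 XiSt (z := z).
have symT := trmx_symm (xi^T *m A *m eta).
split; [exact/iSt_tangentP|exact/iSt_tangentP| |].
- have PD := orth_projD symA symJ J2 XiSt sym1 GX1 def1 proj1.
  rewrite (christoffel1E symA unitA symJ J2 rho_gt0 XiSt tan_xi tan_eta ch1 lc1).
  rewrite 2!PD (orth_projZ symA symJ J2 XiSt sym1 GX1 def1 proj1).
  rewrite (orth_proj_normal symA symJ J2 XiSt sym1 GX1 def1 proj1 symT) addr0.
  congr (_ + _); apply: (orth_proj_id symA symJ J2 XiSt sym1 GX1 def1 proj1).
  exact (trX_A_invA_PiX unitA J2 XiSt _).
- have PD := orth_projD symA symJ J2 XiSt sym2 GX2 def2 proj2.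
  rewrite (christoffel2E symA unitA symJ J2 rho_gt0 XiSt tan_xi tan_eta ch2 lc2).
  rewrite 2!PD.
  rewrite (orth_proj_normal symA symJ J2 XiSt sym2 GX2 def2 proj2 symT) addr0.
  congr (_ + _); apply: (orth_proj_id symA symJ J2 XiSt sym2 GX2 def2 proj2).
  exact (trX_A_invA_SX symA unitA symJ J2 XiSt _).
Qed.
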